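(* Let $k\geq 2$ be an integer and let $0<p\leq 1/4$. Then there exist graphs with arbitrarily large numbers of vertices $n$ (more precisely, a sequence of graphs $G_m$ on $n_m$ vertices with $n_m\to\infty$) such that for every $j=2,\dots,k$ the number of labeled copies of $K_j$ in $G_m$ is $(1+o(1))p^{\binom{j}{2}}n_m^{j}$ as $m\to\infty$, and each $G_m$ contains an independent set of size at least $n_m/2$. Consequently, the family $\mathcal{K}_k=\{K_2,\dots,K_k\}$ is not forcing.
   Context: $K_j$ denotes the complete graph on $j$ vertices. A labeled copy of a graph $H$ in a graph $G$ is an injective map $V(H)\to V(G)$ sending edges of $H$ to edges of $G$. Asymptotic notation $o(1)$ refers to the number of vertices tending to infinity, all other parameters ($k$, $p$, $j$) being fixed. For $0<p<1$, a sequence of graphs $G$ on $n\to\infty$ vertices is called $p$-quasirandom if it has $(1+o(1))pn^2$ labeled edges and $(1+o(1))p^4n^4$ labeled copies of the $4$-cycle $C_4$; equivalently (Chung–Graham–Wilson), for every $c>0$ and every vertex set $S$ with $|S|\geq cn$, the number of labeled edges inside $S$ is $(1+o(1))p|S|^2$. A family of graphs $\mathcal{F}$ is forcing if for every $0<p<1$, every sequence of $n$-vertex graphs $G$ ($n\to\infty$) containing $(1+o(1))n^{|V(F)|}p^{|E(F)|}$ labeled copies of $F$ for every $F\in\mathcal{F}$ is $p$-quasirandom. *)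

(* Defs.v *)
From HB Require Import structures.
From mathcomp Require Import all_boot all_order all_algebra.
From mathcomp Require Import all_classical all_reals all_analysis.
Set Implicit Arguments.
Unset Strict Implicit.
Unset Printing Implicit Defensive.
Import Order.TTheory GRing.Theory Num.Theory.
Import numFieldNormedType.Exports.
Local Open Scope ring_scope.

Record sgraph := SGraph {
  vertex :> finType;
  adj : rel vertex;
  adj_sym : symmetric adj;
  adj_irrefl : irreflexive adj }.

Definition edges (G : sgraph) : {set {set G}} :=
  [set [set z.1; z.2] | z : G * G & adj z.1 z.2].

Definition labeled_copies (H G : sgraph) : {set {ffun H -> G}} :=
  [set f : {ffun H -> G} |
    injectiveb f && [forall x, forall y, adj x y ==> adj (f x) (f y)]].

Definition independent (G : sgraph) (S : {set G}) : bool :=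
  [forall x in S, forall y in S, ~~ adj x y].

Definition complete_adj (j : nat) : rel 'I_j := fun x y => x != y.

Lemma complete_adj_sym j : symmetric (@complete_adj j).
Proof. by move=> x y; rewrite /complete_adj eq_sym. Qed.

Lemma complete_adj_irrefl j : irreflexive (@complete_adj j).
Proof. by move=> x; rewrite /complete_adj eqxx. Qed.

Definition complete_graph (j : nat) : sgraph :=
  SGraph (@complete_adj_sym j) (@complete_adj_irrefl j).

Definition C4_adj : rel 'I_4 :=
  fun x y => (y == x.+1 %% 4 :> nat)%N || (x == y.+1 %% 4 :> nat)%N.

Lemma C4_adj_sym : symmetric C4_adj.
Proof. by move=> x y; rewrite /C4_adj orbC. Qed.

Lemma C4_adj_irrefl : irreflexive C4_adj.
Proof. by case=> [[|[|[|[|]]]]]. Qed.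

Definition C4 : sgraph := SGraph C4_adj_sym C4_adj_irrefl.

Local Open Scope classical_set_scope.

Definition orders_to_infinity (G : nat -> sgraph) : Prop :=
  (fun m => #|G m|) @ \oo --> \oo.

(* [f ~_\oo g] is the library's [f = g +o_\oo g], i.e. f = (1 + o(1)) g. *)
Definition copies_asymptotic (R : realType) (H : sgraph) (G : nat -> sgraph)
    (c : R) : Prop :=
  (fun m => #|labeled_copies H (G m)|%:R : R)
    ~_\oo (fun m => c * #|G m|%:R ^+ #|H| : R).

(* A labeled edge is an ordered pair of adjacent vertices, that is, a labeled
   copy of K_2. *)
Definition quasirandom (R : realType) (p : R) (G : nat -> sgraph) : Prop :=
  [/\ orders_to_infinity G,
      copies_asymptotic (complete_graph 2) G p
    & copies_asymptotic C4 G (p ^+ 4)].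

(* A family of graphs is an [sgraph -> Prop] because [sgraph] is too large a type
   for the library's [set]. *)
Definition forcing (R : realType) (Fam : sgraph -> Prop) : Prop :=
  forall (p : R), 0 < p < 1 ->
  forall G : nat -> sgraph, orders_to_infinity G ->
    (forall F, Fam F -> copies_asymptotic F G (p ^+ #|edges F|)) ->
    quasirandom p G.

Definition complete_family (k : nat) : sgraph -> Prop :=
  fun F => exists2 j : nat, (2 <= j <= k)%N & F = complete_graph j.

(* Main.v *)
Require Import Defs.
From HB Require Import structures.
From mathcomp Require Import all_boot all_order all_algebra.
From mathcomp Require Import all_classical all_reals all_analysis.
From mathcomp Require Import ring lra.
Set Implicit Arguments.
Unset Strict Implicit.
Unset Printing Implicit Defensive.
Import Order.TTheory GRing.Theory Num.Theory.
Import numFieldNormedType.Exports.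
Local Open Scope ring_scope.

(** Take the complete k-partite graph with parts of sizes about [v i * n]. Its
    [K_j] density is [j!] times the j-th elementary symmetric function of [v], so
    the [v i] must satisfy
      [\prod_i (1 + v i X) = \sum_(j <= k) p ^ 'C(j, 2) / j! X ^ j].
    For [p <= 1/4] the polynomial on the right satisfies the Kurtz-Hutchinson
    criterion [a_j ^ 2 >= 4 a_(j-1) a_(j+1)], hence has [k] distinct negative
    roots: at [- 2 m p ^ (1 - m)] the m-th term dominates both of its neighbours
    together, which fixes the sign. The root nearest to [0] lies in [(-2, 0)], so
    one part has more than half of the vertices.
    If these graphs were quasirandom, equality in the Cauchy-Schwarz proof that
    the [C4] density is at least [p ^ 4] would force all degrees, hence all
    [v i], to be equal. *)

(** * Signs of alternating sums with a dominant term *)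

(** The sum is [b 0] minus an alternating sum of the shifted sequence, which by induction lies
    between 0 and [b 1]. *)
Lemma alternating_sum_itv (R : realDomainType) (b : nat -> R) n :
  (forall i, 0 <= b i) -> (forall i, b i.+1 <= b i) ->
  0 <= \sum_(i < n) (-1) ^+ i * b i <= b 0%N.
Proof.
elim: n b => [|n IHn] b b_ge0 b_decr; first by rewrite big_ord0 lexx b_ge0.
have /andP[s_ge0 s_le] := IHn _ (fun i => b_ge0 i.+1) (fun i => b_decr i.+1).
rewrite big_ord_recl expr0 mul1r.
under eq_bigr do rewrite lift0 exprS -mulrA mulN1r.
rewrite sumrN subr_ge0 (le_trans s_le (b_decr _)) /=.
by rewrite lerBlDr lerDl.
Qed.

(** While the terms at least double, each partial sum, taken with the sign of its last term [b i],
    lies in [[b i / 2, b i]]. After the peak the terms decrease, so the tail is at most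
    [b m.+1 < b m / 2] in absolute value and cannot cancel the head. *)
Lemma alternating_peak (R : realFieldType) (b : nat -> R) m n :
  (forall j, 0 < b j) ->
  (forall j, (j < m)%N -> 2 * b j <= b j.+1) ->
  (forall j, (m <= j)%N -> 2 * b j.+1 < b j) ->
  (m <= n)%N ->
  0 < (-1) ^+ m * \sum_(j < n.+1) (-1) ^+ j * b j.
Proof.
move=> b_gt0 b_incr b_decr le_mn.
have head i : (i <= m)%N ->
    b i / 2 <= (-1) ^+ i * \sum_(j < i.+1) (-1) ^+ j * b j <= b i.
  elim: i => [_|i IHi lt_im].
    rewrite big_ord1 !expr0 !mul1r lexx andbT.
    by have := b_gt0 0%N; lra.
  have /andP[+ +] := IHi (ltnW lt_im).
  rewrite [in X in _ -> _ -> X]big_ord_recr /= mulrDr.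
  rewrite [X in _ -> _ -> is_true (_ <= _ + X <= _)]mulrA -expr2 sqrr_sign mul1r.
  rewrite [in X in _ -> _ -> X]exprS mulN1r mulNr.
  by have := b_incr i lt_im; have := b_gt0 i; lra.
have tail : - b m.+1 <=
    (-1) ^+ m * \sum_(m.+1 <= j < n.+1) (-1) ^+ j * b j.
  have /andP[_ sum_le] : 0 <= \sum_(i < n - m) (-1) ^+ i * b (m.+1 + i)%N
      <= b (m.+1 + 0)%N.
    apply: (alternating_sum_itv (b := fun i => b (m.+1 + i)%N)) => i.
      exact: ltW.
    rewrite addnS; have := b_decr (m.+1 + i)%N (leqW (leq_addr i m)).
    by have := b_gt0 (m.+1 + i).+1; lra.
  suff -> : (-1) ^+ m * \sum_(m.+1 <= j < n.+1) (-1) ^+ j * b j =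
      - \sum_(i < n - m) (-1) ^+ i * b (m.+1 + i)%N.
    by rewrite lerN2 (le_trans sum_le) ?addn0.
  rewrite -{1}[m.+1]add0n big_addn subSS big_mkord mulr_sumr -sumrN.
  apply: eq_bigr => i _; rewrite [(i + _)%N]addnC mulrA addSn exprS exprD.
  by rewrite mulN1r mulrN mulrA -expr2 sqrr_sign mul1r mulNr.
rewrite -(big_mkord xpredT (fun j => (-1) ^+ j * b j)).
rewrite (@big_cat_nat _ _ _ m.+1) //= mulrDr.
rewrite big_mkord.
by have /andP[{}head _] := head m (leqnn m); have := b_decr m (leqnn m); lra.
Qed.

(** * The clique polynomial and its real roots *)

(** The coefficient of [X ^ j] is the target density of [K_j] divided by [j!]. Since ['C(0, 2)] and
    ['C(1, 2)] vanish, the polynomial starts with [1 + X]; the linear coefficient will make the part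
    weights sum to 1. *)
Definition clique_poly (R : fieldType) (p : R) (k : nat) : {poly R} :=
  \poly_(j < k.+1) (p ^+ 'C(j, 2) / j`!%:R).

Lemma clique_poly_sign (R : realFieldType) (p : R) (k m : nat) :
  0 < p -> p <= 1 / 4 -> (m <= k)%N ->
  0 < (-1) ^+ m * (clique_poly p k).[- (2 * m%:R * p / p ^+ m)].
Proof.
move=> p_gt0 p_le le_mk; case: m le_mk => [_|m le_mk].
  rewrite !mulr0 !mul0r oppr0 horner_poly big_ord_recl /= big1 => [|i _].
    by rewrite expr0 mul1r expr0 divr1 mulr1 addr0.
  by rewrite expr0n mulr0.
(* From here on [m] is the predecessor of the index in the statement. The ratio of consecutive terms
   is [x p ^ j / (j + 1)], and [x p ^ m = 2 (m + 1)] makes it at least 2 exactly up to the peak at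
   [m.+1]. *)
set x := 2 * _ * p / _.
have xE : x * p ^+ m = 2 * m.+1%:R.
  by rewrite /x exprS; field; rewrite expf_neq0 gt_eqF.
have x_gt0 : 0 < x by rewrite /x divr_gt0 ?exprn_gt0 ?mulr_gt0 ?ltr0n.
pose b j := p ^+ 'C(j, 2) / j`!%:R * x ^+ j.
have b_gt0 j : 0 < b j.
  by rewrite /b mulr_gt0 ?divr_gt0 ?exprn_gt0 // ltr0n fact_gt0.
have bS j : j.+1%:R * b j.+1 = x * p ^+ j * b j.
  rewrite /b binS bin1 factS natrM exprD exprS; field.
  by rewrite nat1r !pnatr_eq0 andbT -lt0n fact_gt0.
have p_le1 : p <= 1 by lra.
have -> : (clique_poly p k).[- x] = \sum_(j < k.+1) (-1) ^+ j * b j.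
  by rewrite horner_poly; apply: eq_bigr => j _; rewrite (exprNn x) mulrCA.
apply: alternating_peak => // j.
- rewrite ltnS => le_jm; rewrite -(ler_pM2l (ltr0Sn R j)) bS.
  rewrite mulrCA mulrA ler_wpM2r ?(ltW (b_gt0 _)) //.
  apply: (@le_trans _ _ (x * p ^+ m)).
    by rewrite xE ler_wpM2l // ler_nat.
  by rewrite ler_wpM2l ?(ltW x_gt0) // ler_wiXn2l // ltW.
(* Past the peak the ratio is at most [2 (m + 1) p / (m + 2)], which is below 1/2 because
   [p <= 1/4]. *)
- move=> le_mj; rewrite -(ltr_pM2l (ltr0Sn R j)) mulrCA bS.
  rewrite mulrA ltr_pM2r //.
  apply: (@le_lt_trans _ _ (2 * (x * p ^+ m.+1))).
    rewrite ler_wpM2l // ler_wpM2l ?(ltW x_gt0) // ler_wiXn2l // ltW //.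
  have -> : x * p ^+ m.+1 = 2 * m.+1%:R * p by rewrite exprSr mulrA xE.
  have : m.+2%:R <= j.+1%:R :> R by rewrite ler_nat.
  have : 0 < m.+1%:R :> R by rewrite ltr0Sn.
  rewrite -[m.+2]addn1 natrD; nra.
Qed.

(** Nonzero values at the endpoints exclude them as roots. Strict bounds keep roots from adjacent
    intervals distinct and the first root away from 0 and -2. *)
Lemma poly_ivt_lt (R : rcfType) (q : {poly R}) (a b : R) :
  a <= b -> q.[a] * q.[b] < 0 -> exists2 x, a < x < b & root q x.
Proof.
move=> le_ab; wlog qa_lt0 : q / q.[a] < 0 => [wlog_q|].
  case: (ltgtP q.[a] 0) => [qa|qa|->]; [exact: wlog_q| |by rewrite mul0r ltxx].
  move=> qab; have := wlog_q (- q); rewrite !hornerN oppr_lt0 mulrNN.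
  by move=> /(_ qa qab)[x itv_x]; rewrite rootN; exists x.
rewrite nmulr_rlt0 // => qb_gt0.
have [|x /andP[ax xb] rx] := @poly_ivt R q a b le_ab.
  by rewrite (ltW qa_lt0) (ltW qb_gt0).
exists x => //; rewrite !lt_neqAle ax xb !andbT; apply/andP; split.
  by apply: contraTneq qa_lt0 => ->; rewrite (rootP rx) ltxx.
by apply: contraTneq qb_gt0 => <-; rewrite (rootP rx) ltxx.
Qed.

Lemma clique_poly_factorization (R : rcfType) (p : R) (k : nat) :
  0 < p -> p <= 1 / 4 ->
  exists v : 'I_k -> R,
    [/\ forall i, 0 < v i, injective v,
        forall i : 'I_k, i = 0%N :> nat -> 1 / 2 < v i
      & \prod_i (1 + v i *: 'X) = clique_poly p k].
Proof.
move=> p_gt0 p_le; have p_le1 : p <= 1 by lra.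
(* The polynomial changes sign between [- x i] and [- x i.+1]. In particular [x 0 = 0] and
   [x 1 = 2], so the first root [- r 0] lies in [(-2, 0)] and its weight [1 / r 0] exceeds 1/2. *)
pose x m : R := 2 * m%:R * p / p ^+ m.
have x_mono : {homo x : m n / (m <= n)%N >-> m <= n}.
  apply: homo_leq => [//|? ? ?|m]; first exact: le_trans.
  have -> : x m.+1 = 2 * m.+1%:R / p ^+ m.
    by rewrite /x exprS; field; rewrite expf_neq0 gt_eqF.
  rewrite /x ler_pM2r ?invr_gt0 ?exprn_gt0 // -mulrA ler_wpM2l //.
  by rewrite -natr1 -[m%:R]mulr1 -mulrA mul1r ler_wpDr // ler_wpM2l.
have root_ex (i : 'I_k) : exists r, x i < r < x i.+1 /\ root (clique_poly p k) (- r).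
  have := @poly_ivt_lt R (clique_poly p k) (- x i.+1) (- x i).
  rewrite lerN2 x_mono // => /(_ isT); case.
    have := clique_poly_sign p_gt0 p_le (ltn_ord i).
    have := clique_poly_sign p_gt0 p_le (ltnW (ltn_ord i)).
    rewrite -/(x i) -/(x i.+1) exprS.
    move: (clique_poly _ _).[_] (clique_poly _ _).[_] => u w.
    move=> u0 w0; have := mulr_gt0 u0 w0.
    rewrite mulN1r mulNr mulrN mulrACA -expr2 sqrr_sign mul1r.
    by rewrite oppr_gt0 mulrC.
  move=> r /andP[r1 r2] rr; exists (- r); rewrite opprK; split => //.
  by rewrite ltrNr r2 ltrNl r1.
have {root_ex} [r r_root] := fin_all_exists root_ex.
have r_gt0 i : 0 < r i.
  have [/andP[+ _] _] := r_root i.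
  by apply: le_lt_trans; have := x_mono 0%N i (leq0n _); rewrite {1}/x mulr0 !mul0r.
have r_lt (i j : 'I_k) : (i < j)%N -> r i < r j.
  move=> lt_ij; have [/andP[_ ri] _] := r_root i; have [/andP[rj _] _] := r_root j.
  exact: lt_trans (lt_le_trans ri (x_mono _ _ lt_ij)) rj.
have r_inj : injective r.
  move=> i j rij; apply/val_inj => /=.
  by case: (ltngtP i j) => // /r_lt; rewrite rij ltxx.
exists (fun i => (r i)^-1); split => [i|i j /invr_inj/r_inj //|i i0|].
- by rewrite invr_gt0.
- have [/andP[_ ri] _] := r_root i.
  have {}ri : r i < 2 by move: ri; rewrite i0 /x mulr1 expr1 mulfK ?gt_eqF.
  by rewrite div1r ltf_pV2 ?posrE.
(* The degree is exactly [k], so the [k] distinct roots found are all the roots. *)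
have lead_neq0 : p ^+ 'C(k, 2) / k`!%:R != 0.
  by rewrite gt_eqF // divr_gt0 ?exprn_gt0 // ltr0n fact_gt0.
have QE : clique_poly p k =
    lead_coef (clique_poly p k) *: \prod_i ('X - (- r i)%:P).
  rewrite -[in RHS]big_enum /= -(big_map (fun i => - r i) xpredT (fun z => 'X - z%:P)).
  apply: all_roots_prod_XsubC.
  - by rewrite size_map size_enum_ord size_poly_eq.
  - by apply/allP => _ /mapP[i _ ->]; case: (r_root i).
  - by rewrite uniq_rootsE map_inj_uniq ?enum_uniq // => i j /oppr_inj/r_inj.
have prodE : \prod_i ('X - (- r i)%:P) =
    (\prod_i r i) *: \prod_i (1 + (r i)^-1 *: 'X).
  rewrite -scaler_prod; apply: eq_bigr => i _.
  by rewrite scalerDr scalerA divff ?gt_eqF // scale1r polyCN opprK addrC alg_polyC.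
rewrite prodE scalerA in QE; rewrite [RHS]QE.
(* Both the clique polynomial and the product of the [1 + v i X] take the value 1 at 0, so the
   remaining scalar factor is 1. *)
have := congr1 (fun q => q.[0]) QE.
rewrite /= hornerZ horner_prod [X in _ * X]big1 => [|i _]; last by rewrite !(hornerE, mulr0, addr0).
have := @clique_poly_sign R p k 0 p_gt0 p_le isT.
rewrite mulr1 => _ <-.
rewrite horner_coef0 coef_poly /= expr0 divr1.
by rewrite scale1r.
Qed.

(** * Elementary symmetric functions as coefficients *)

(** Expanding the product over subsets, the coefficient of [X ^ j] sums [\prod_(t in A) v t] over
    the [j]-element sets [A], and each such [A] is the image of [j!] injections. *)
Lemma sum_injective_ffun (R : comNzRingType) (T : finType) (v : T -> R) j :
  \sum_(f : {ffun 'I_j -> T} | injectiveb f) \prod_i v (f i) =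
    j`!%:R * (\prod_t (1 + v t *: 'X))`_j.
Proof.
under [in RHS]eq_bigr do rewrite addrC.
rewrite bigA_distr coef_sum mulr_sumr.
rewrite (partition_big (fun f : {ffun 'I_j -> T} => f @: [set: 'I_j]) xpredT) //=.
apply: eq_bigr => A _.
rewrite -big_mkcond /= scaler_prod prodr_const coefZ coefXn.
have [jA|jA] := eqVneq j #|A|; last first.
  rewrite !mulr0 big_pred0 // => f; apply/negP => /andP[/injectiveP f_inj /eqP fA].
  by move: jA; rewrite -fA card_imset // cardsT card_ord eqxx.
rewrite (eq_bigr (fun=> \prod_(t in A) v t)) => [|f /andP[/injectiveP f_inj /eqP <-]].
  rewrite mulr1 sumr_const -[LHS]mulr_natl; congr (_%:R * _).
  have := card_inj_ffuns_on 'I_j [in A]; rewrite card_ord -jA ffactnn => <-.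
  rewrite cardsE; apply: eq_card => f. rewrite [LHS]unfold_in [RHS]unfold_in andbC.
  apply: andb_id2r => /injectiveP f_inj; apply/eqP/ffun_onP => [<- i|fA].
    by rewrite imset_f.
  apply/eqP; rewrite eqEcard card_imset // cardsT card_ord -jA leqnn andbT.
  by apply/fintype.subsetP => _ /imsetP[i _ ->]; apply: fA.
by rewrite big_imset => [|? ? _ _ /f_inj//]; apply: eq_bigl => i; rewrite finset.in_setT.
Qed.

(** The last identity is Newton's [2 e_2 = p_1 ^ 2 - p_2]. It lets the sum and the sum of squares of
    the weights be read off the clique polynomial. *)
Lemma coef12_prod_linear (R : comNzRingType) (I : Type) (r : seq I) (v : I -> R) :
  let P := \prod_(i <- r) (1 + v i *: 'X) in
  [/\ P`_0 = 1, P`_1 = \sum_(i <- r) v i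
    & 2 * P`_2 = (\sum_(i <- r) v i) ^+ 2 - \sum_(i <- r) v i ^+ 2].
Proof.
elim: r => [|i r [IH0 IH1 IH2]] /=; first by rewrite !big_nil !coef1; split=> //=; ring.
rewrite !big_cons mulrDl mul1r -scalerAl !coefD !coefZ !coefXM /= IH0 IH1.
by split; [ring|ring|rewrite mulrDr IH2; ring].
Qed.

(** * Complete multipartite graphs and their cliques *)

Section Multipartite.
Variables (I : finType) (s : I -> nat).

Let vert : finType := {i : I & 'I_(s i)}.

Definition multipartite_adj : rel vert := fun x y => tag x != tag y.

Fact multipartite_adj_sym : symmetric multipartite_adj.
Proof. by move=> x y; rewrite /multipartite_adj eq_sym. Qed.

Fact multipartite_adj_irrefl : irreflexive multipartite_adj.
Proof. by move=> x; rewrite /multipartite_adj eqxx. Qed.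

Definition multipartite : sgraph :=
  SGraph multipartite_adj_sym multipartite_adj_irrefl.

Definition part (i : I) : {set multipartite} := [set x | tag (x : vert) == i].

Lemma card_part i : #|part i| = s i.
Proof.
rewrite -[RHS]card_ord.
have inj_T : injective (fun u : 'I_(s i) => (Tagged (fun i => 'I_(s i)) u : multipartite)).
  by move=> u w /eqP; rewrite eq_Tagged => /eqP.
rewrite -(card_imset _ inj_T); apply: eq_card => x; rewrite inE.
apply/eqP/imsetP => [|[u _ ->] //].
by case: x => j u /= ji; case: _ / ji u => u; exists u.
Qed.

Lemma independent_part i : independent (part i).
Proof.
apply/forallP => x; apply/implyP; rewrite inE => /eqP xi.
apply/forallP => y; apply/implyP; rewrite inE => /eqP yi.
by rewrite /= /multipartite_adj xi yi eqxx.
Qed.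

Lemma sum_multipartite (V : nmodType) (F : I -> V) :
  \sum_(x : multipartite) F (tag (x : vert)) = \sum_i F i *+ s i.
Proof.
rewrite (partition_big (fun x : multipartite => tag (x : vert)) xpredT) //=.
apply: eq_bigr => i _; rewrite -[s i]card_part -sumr_const.
by apply: eq_big => [x|x /eqP->//]; rewrite inE.
Qed.

Lemma card_multipartite : #|multipartite| = (\sum_i s i)%N.
Proof.
rewrite -sum1_card (partition_big (fun x : multipartite => tag (x : vert)) xpredT) //=.
by apply: eq_bigr => i _; rewrite -card_part -sum1_card; apply: eq_bigl => x; rewrite inE.
Qed.

(** Adjacent vertices lie in different parts, so a copy of [K_j] determines an injection [g] into
    the set of parts. The copies over a given [g] choose one vertex freely in each part [g i]. *)
Lemma card_complete_copies j :
  #|labeled_copies (complete_graph j) multipartite| =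
    (\sum_(f : {ffun 'I_j -> I} | injectiveb f) \prod_i s (f i))%N.
Proof.
rewrite -sum1_card.
rewrite (partition_big (fun f : {ffun 'I_j -> vert} => [ffun i => tag (f i)])
   (fun f => injectiveb f)) /=; last first.
  move=> f; rewrite inE => /andP[_ /forallP f_adj]; apply/injectiveP => x y.
  rewrite !ffunE => /eqP fxy; apply/eqP; apply: contraTT fxy => neq_xy.
  by have /forallP/(_ y)/implyP/(_ neq_xy) := f_adj x.
apply: eq_bigr => g /injectiveP g_inj.
rewrite sum1_card -(eq_card (A := family (fun i => mem (part (g i))))).
  rewrite card_family foldrE big_map big_enum.
  by apply: eq_bigr => i _; rewrite card_part.
move=> f; rewrite !inE; apply/familyP/andP => [fg|[_ /eqP <-] i]; last first.
  by rewrite inE ffunE.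
have {}fg i : tag (f i : vert) = g i by have := fg i; rewrite inE => /eqP.
split; last by apply/eqP/ffunP => i; rewrite ffunE.
rewrite inE; apply/andP; split.
  by apply/injectiveP => x y fxy; apply: g_inj; rewrite -!fg fxy.
apply/forallP => x; apply/forallP => y; apply/implyP => neq_xy.
by rewrite /= /multipartite_adj !fg (inj_eq g_inj).
Qed.

End Multipartite.

(** * A lower bound for the number of four-cycles *)

(** Cauchy-Schwarz, obtained by expanding the sum of the squares [(N a_i - S) ^ 2], where [S] is the
    sum and [N] the number of terms. *)
Lemma sqr_sum_le (R : realFieldType) (T : finType) (a : T -> R) :
  (\sum_i a i) ^+ 2 <= #|T|%:R * \sum_i a i ^+ 2.
Proof.
have [T0|T_gt0] := posnP #|T|.
  by rewrite T0 mul0r big_pred0 ?expr0n // => i; have := fintype0 i T0.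
set S := \sum_i a i; set Q := \sum_i a i ^+ 2; set N : R := #|T|%:R.
have N_gt0 : 0 < N by rewrite ltr0n.
have : 0 <= \sum_i (N * a i - S) ^+ 2 by apply: sumr_ge0 => i _; exact: sqr_ge0.
rewrite (eq_bigr (fun i => N ^+ 2 * a i ^+ 2 + - (2 * N * S) * a i + S ^+ 2)) => [|i _].
  rewrite !big_split /= sumr_const -!mulr_sumr -[S ^+ 2 *+ _]mulr_natl -/S -/Q -/N.
  have -> : N ^+ 2 * Q + - (2 * N * S) * S + N * S ^+ 2 = N * (N * Q - S ^+ 2) by ring.
  by rewrite pmulr_rge0 // subr_ge0.
by ring.
Qed.

Definition codegree (G : sgraph) (x z : G) : nat := #|[set y | adj x y & adj y z]|.

(* The left-hand side counts homomorphisms of [C4]; a non-injective one identifies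
   two opposite vertices. *)
Lemma sum_codegree_sqr_le (G : sgraph) :
  (\sum_(q : G * G) codegree q.1 q.2 ^ 2 <=
     #|labeled_copies C4 G| + 2 * #|G| ^ 3)%N.
Proof.
(* An element [((x, z), (y, w))] of [Q] is a closed walk x, y, z, w with opposite vertices paired.
   Below, [diag1] collects the case [x = z] and [diag2] the case [y = w]. *)
pose Q := [set q : (G * G) * (G * G) | [&& adj q.1.1 q.2.1, adj q.2.1 q.1.2,
  adj q.1.1 q.2.2 & adj q.2.2 q.1.2]].
have <- : #|Q| = (\sum_(q : G * G) codegree q.1 q.2 ^ 2)%N.
  rewrite -sum1_card.
  transitivity (\sum_(q : G * G) \sum_(t : G * G | (q, t) \in Q) 1)%N.
    by rewrite pair_big_dep; apply: eq_bigl => -[q t].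
  apply: eq_bigr => q _; rewrite sum1_card -mulnn -cardsX.
  apply: eq_card => t; transitivity ((q, t) \in Q) => //.
  by rewrite !inE /= -andbA.
pose diag1 := [set ((u.1, u.1), u.2) | u : G * (G * G)].
pose diag2 := [set (u.2, (u.1, u.1)) | u : G * (G * G)].
pose tuple4 (q : (G * G) * (G * G)) := [:: q.1.1; q.2.1; q.1.2; q.2.2].
pose phi (q : (G * G) * (G * G)) : {ffun C4 -> G} :=
  [ffun i : 'I_4 => nth q.1.1 (tuple4 q) i].
have phi_inj : injective phi.
  move=> [[x z] [y w]] [[x' z'] [y' w']] /ffunP phiE.
  have phi_at (i : 'I_4) := phiE i.
  have := phi_at (@Ordinal 4 0 isT); have := phi_at (@Ordinal 4 1 isT).
  have := phi_at (@Ordinal 4 2 isT); have := phi_at (@Ordinal 4 3 isT).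
  by rewrite !ffunE /= => -> -> -> ->.
have card_diag (f : G * (G * G) -> (G * G) * (G * G)) :
    (#|[set f u | u : G * (G * G)]| <= #|G| ^ 3)%N.
  by rewrite (leq_trans (leq_imset_card _ _)) // !card_prod expnS -mulnn.
rewrite -(card_imset (mem Q) phi_inj).
have phi_Q : phi @: Q \subset labeled_copies C4 G :|: (phi @: diag1 :|: phi @: diag2).
  apply/fintype.subsetP => _ /imsetP[[[x z] [y w]] + ->].
  rewrite inE /= => /and4P[xy yz xw wz].
  have [xz|neq_xz] := eqVneq x z.
    by rewrite !finset.in_setU (imset_f phi (x := ((x, z), (y, w)))) ?orbT //;
      apply/imsetP; exists (x, (y, w)) => //=; rewrite xz.
  have [yw|neq_yw] := eqVneq y w.
    by rewrite !finset.in_setU [_ \in phi @: diag2](imset_f phi (x := ((x, z), (y, w)))) ?orbT //;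
      apply/imsetP; exists (y, (x, z)) => //=; rewrite yw.
  have neq_adj (u t : G) : adj u t -> u != t.
    by move=> ut; apply: contraTneq ut => ->; rewrite adj_irrefl.
  have tuple_uniq : uniq (tuple4 ((x, z), (y, w))).
    by rewrite /= !inE !negb_or neq_xz neq_yw !neq_adj //= adj_sym.
  rewrite !finset.in_setU; apply/orP; left; rewrite inE; apply/andP; split.
    apply/injectiveP => i j; rewrite !ffunE => /eqP.
    by rewrite nth_uniq // => /eqP/val_inj.
  apply/forallP => i; apply/forallP => j; apply/implyP; rewrite !ffunE.
  by case: i j => [[|[|[|[|//]]]] ?] [[|[|[|[|//]]]] ?] //= _; rewrite // adj_sym.
apply: leq_trans (subset_leq_card phi_Q) _.
rewrite (leq_trans (leq_card_setU _ _)) // leq_add2l mul2n -addnn.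
rewrite (leq_trans (leq_card_setU _ _)) // leq_add //.
  by rewrite card_imset ?card_diag.
by rewrite card_imset ?card_diag.
Qed.

Definition degree (G : sgraph) (y : G) : nat := #|[set x | adj x y]|.

(** Walks of length two are counted by their ends on the left and by their middle vertex on the
    right. *)
Lemma sum_codegree (G : sgraph) :
  (\sum_(q : G * G) codegree q.1 q.2 = \sum_(y : G) degree y ^ 2)%N.
Proof.
have card_sum (P : pred G) : #|[set y | P y]| = (\sum_y P y)%N.
  rewrite -sum1_card big_mkcond; apply: eq_bigr => y _.
  by rewrite inE; case: (P y).
rewrite (eq_bigr (fun q : G * G => \sum_y (adj q.1 y && adj y q.2))%N); last first.
  by move=> q _; rewrite -card_sum.
rewrite exchange_big /=; apply: eq_bigr => y _.
rewrite -mulnn /degree card_sum big_distrlr pair_bigA; apply: eq_bigr => q _.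
by rewrite /= mulnb [adj y _]adj_sym.
Qed.

(** The sum of squared degrees is the sum of the codegrees; Cauchy-Schwarz over the [n ^ 2] ordered
    pairs compares it with the sum of squared codegrees. *)
Lemma C4_copies_ge (R : realFieldType) (G : sgraph) :
  (\sum_(y : G) (degree y)%:R ^+ 2) ^+ 2 <=
    #|G|%:R ^+ 2 * (#|labeled_copies C4 G|%:R + 2 * #|G|%:R ^+ 3) :> R.
Proof.
have -> : \sum_(y : G) (degree y)%:R ^+ 2 = \sum_(q : G * G) (codegree q.1 q.2)%:R :> R.
  by rewrite -natr_sum sum_codegree natr_sum; apply: eq_bigr => y _; rewrite natrX.
apply: le_trans (sqr_sum_le _) _.
rewrite card_prod natrM -expr2 ler_wpM2l ?exprn_ge0 //.
under eq_bigr do rewrite -natrX.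
by rewrite -natr_sum -!natrX -natrM -natrD ler_nat sum_codegree_sqr_le.
Qed.

Lemma degree_multipartite (I : finType) (s : I -> nat) (y : multipartite s) :
  (degree y + s (tag (y : {i : I & 'I_(s i)})))%N = #|multipartite s|.
Proof.
rewrite -[s _]card_part -(cardsC (part s (tag (y : {i : I & 'I_(s i)})))) addnC; congr (_ + _)%N.
by apply: eq_card => x; rewrite !inE.
Qed.

(** A vertex of part [i] has degree [n - s i]; the bound is [C4_copies_ge] divided by [n ^ 6]. *)
Lemma C4_copies_multipartite_ge (R : realFieldType) (I : finType) (s : I -> nat) :
  let n : R := #|multipartite s|%:R in
  0 < n ->
  (\sum_i (s i)%:R / n * (1 - (s i)%:R / n) ^+ 2) ^+ 2 <=
    #|labeled_copies C4 (multipartite s)|%:R / n ^+ 4 + 2 / n.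
Proof.
move=> n n_gt0; have := C4_copies_ge R (multipartite s); rewrite -/n.
set c := #|labeled_copies _ _|%:R.
have -> : \sum_(y : multipartite s) (degree y)%:R ^+ 2 =
    n ^+ 3 * \sum_i (s i)%:R / n * (1 - (s i)%:R / n) ^+ 2.
  rewrite (eq_bigr (fun y : multipartite s =>
      (n - (s (tag (y : {i : I & 'I_(s i)})))%:R) ^+ 2)) => [|y _].
    rewrite (sum_multipartite s (fun i => (n - (s i)%:R) ^+ 2)) mulr_sumr.
    by apply: eq_bigr => i _; rewrite -mulr_natl; field; rewrite gt_eqF.
  by rewrite /n -(degree_multipartite y) natrD addrK.
rewrite exprMn -exprM => le_c.
rewrite -(ler_pM2l (exprn_gt0 6 n_gt0)); apply: le_trans le_c _.
rewrite le_eqVlt; apply/orP; left; apply/eqP; field.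
by rewrite gt_eqF.
Qed.

(** * Limits of densities and rounding of part sizes *)

Local Open Scope classical_set_scope.

(** Dividing by the power of the order turns asymptotic equivalence into convergence of densities,
    with the error rescaled by [c]. Limits of sums and products then apply. *)
Lemma copies_asymptoticP (R : realType) (H : sgraph) (G : nat -> sgraph) (c : R) :
  0 < c -> (forall m, 0 < #|G m|)%N ->
  copies_asymptotic H G c <->
  (#|labeled_copies H (G m)|%:R / #|G m|%:R ^+ #|H| : R) @[m --> \oo] --> c.
Proof.
move=> c_gt0 G_gt0.
have n_gt0 m : 0 < #|G m|%:R ^+ #|H| :> R by rewrite exprn_gt0 ?ltr0n.
have normE m : `|#|labeled_copies H (G m)|%:R - c * #|G m|%:R ^+ #|H| : R| =
    `|c - #|labeled_copies H (G m)|%:R / #|G m|%:R ^+ #|H| | * #|G m|%:R ^+ #|H|.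
  rewrite [X in `|X - _|](_ : _ = #|labeled_copies H (G m)|%:R /
    #|G m|%:R ^+ #|H| * #|G m|%:R ^+ #|H|); last by rewrite divfK ?gt_eqF.
  by rewrite -mulrBl normrM distrC (gtr0_norm (n_gt0 m)).
rewrite /copies_asymptotic; split=> [/eqaddoP lim_o|/cvgrPdist_le lim_c].
  apply/cvgrPdist_le => e e_gt0.
  apply: filterS (lim_o (e / c) (divr_gt0 e_gt0 c_gt0)) => m /=.
  rewrite !fctE normE normrM [`|_ ^+ _|]gtr0_norm // mulrA ler_pM2r //.
  by rewrite gtr0_norm // divfK ?gt_eqF.
apply/eqaddoP => e e_gt0.
apply: filterS (lim_c (e * c) (mulr_gt0 e_gt0 c_gt0)) => m /=.
by rewrite !fctE normE normrM [`|_ ^+ _|]gtr0_norm // mulrA ler_pM2r // gtr0_norm.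
Qed.

Lemma cvg_truncn_div (R : realType) (x : R) : 0 <= x ->
  ((Num.truncn (x * m.+1%:R))%:R / m.+1%:R : R) @[m --> \oo] --> x.
Proof.
move=> x_ge0.
apply: (@squeeze_cvgr _ _ _ _ (fun m => x - m.+1%:R^-1) (fun=> x)).
- apply: nearW => m; have m_gt0 : 0 < m.+1%:R :> R by rewrite ltr0n.
  have /truncn_itv/andP[] : 0 <= x * m.+1%:R by rewrite mulr_ge0.
  rewrite ler_pdivrMr // ler_pdivlMr // => -> /ltW; rewrite andbT.
  by rewrite mulrBl mulVf ?gt_eqF // lerBlDr natr1.
- rewrite -[x in _ --> x]subr0; apply: cvgB; [exact: cvg_cst | exact: cvg_harmonic].
- exact: cvg_cst.
Qed.

Section PartSize.
Variables (R : realType) (k : nat) (v : 'I_k.+1 -> R).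
Hypotheses (v_ge0 : forall i, 0 <= v i) (sum_v : \sum_i v i = 1).

(* Part [ord0] absorbs all rounding errors, so the total is exactly [m.+1] and the
   largest part is never rounded down. *)
Definition part_size (m : nat) (i : 'I_k.+1) : nat :=
  if i == ord0 then (m.+1 - \sum_(j | j != ord0) Num.truncn (v j * m.+1%:R))%N
  else Num.truncn (v i * m.+1%:R).

(** The rounded-down sizes of the other parts total at most [(1 - v ord0) (m + 1)], so the
    natural-number subtraction in [part_size] never truncates and leaves at least
    [v ord0 (m + 1)]. *)
Lemma part_size0 m : (part_size m ord0)%:R =
  m.+1%:R - \sum_(j | j != ord0) (Num.truncn (v j * m.+1%:R))%:R :> R
  /\ v ord0 * m.+1%:R <= (part_size m ord0)%:R.
Proof.
have le_v : \sum_(j | j != ord0) (Num.truncn (v j * m.+1%:R))%:R <=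
    m.+1%:R - v ord0 * m.+1%:R.
  have nE : m.+1%:R = (v ord0 + \sum_(j | j != ord0) v j) * m.+1%:R.
    by rewrite -[LHS]mul1r -sum_v (bigD1 ord0).
  rewrite lerBrDr [X in _ <= X]nE mulrDl addrC lerD2l mulr_suml; apply: ler_sum => j _.
  by rewrite truncn_le mulr_ge0.
suff eq_size : (part_size m ord0)%:R =
  m.+1%:R - \sum_(j | j != ord0) (Num.truncn (v j * m.+1%:R))%:R :> R.
  by rewrite eq_size; split=> //; rewrite lerBrDl -lerBrDr.
rewrite /part_size eqxx natrB ?natr_sum // -(ler_nat R) natr_sum.
by apply: le_trans le_v _; rewrite lerBlDr lerDl mulr_ge0.
Qed.

Lemma sum_part_size m : (\sum_i part_size m i)%N = m.+1.
Proof.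
apply/eqP; rewrite -(eqr_nat R) natr_sum (bigD1 ord0) //= (part_size0 m).1.
rewrite [X in _ + X](eq_bigr (fun j => (Num.truncn (v j * m.+1%:R))%:R)) => [|i i0].
  by rewrite subrK.
by rewrite /part_size (negbTE i0).
Qed.

Lemma cvg_part_size i : ((part_size m i)%:R / m.+1%:R : R) @[m --> \oo] --> v i.
Proof.
have [->|i0] := eqVneq i ord0; last first.
  rewrite /part_size (negbTE i0); exact: cvg_truncn_div.
have -> : v ord0 = 1 - \sum_(j | j != ord0) v j.
  by rewrite -sum_v (bigD1 ord0) //= addrK.
have -> : (fun m => (part_size m ord0)%:R / m.+1%:R : R) =
    (fun m => 1 - \sum_(j | j != ord0) (Num.truncn (v j * m.+1%:R))%:R / m.+1%:R).
  apply/funext => m; rewrite (part_size0 m).1 mulrBl divff ?pnatr_eq0 //.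
  by rewrite mulr_suml.
apply: cvgB; first exact: cvg_cst.
by apply: cvg_big => [|j _]; [exact: add_continuous | exact: cvg_truncn_div].
Qed.

End PartSize.

(** * Clique and four-cycle densities of the construction *)

Lemma card_edges_complete j : #|edges (complete_graph j)| = 'C(j, 2).
Proof.
rewrite -[in RHS](card_ord j) -card_draws; apply: eq_card => A; rewrite inE.
apply/imsetP/cards2P => [[z + ->]|[x [y [neq_xy ->]]]].
  by rewrite inE => ?; exists z.1, z.2.
by exists (x, y); rewrite ?inE.
Qed.

Lemma cvg_sqr (R : realType) (f : nat -> R) (l : R) :
  f @ \oo --> l -> (f m ^+ 2) @[m --> \oo] --> l ^+ 2.
Proof. by move=> f_l; rewrite expr2; under eq_fun do rewrite expr2; exact: cvgM. Qed.

Section CliqueMultipartite.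
Variables (R : realType) (p : R) (k : nat) (v : 'I_k.+1 -> R).
Hypotheses (p_gt0 : 0 < p) (v_ge0 : forall i, 0 <= v i).
Hypothesis vE : \prod_i (1 + v i *: 'X) = clique_poly p k.+1.

Lemma clique_weights_sum : \sum_i v i = 1.
Proof.
have [_ <- _] := coef12_prod_linear (index_enum 'I_k.+1) v.
by rewrite vE coef_poly /= expr0 divr1.
Qed.

(** The coefficient of [X ^ 2] is [p / 2], so Newton's identity gives [p = 1 - \sum_i v i ^ 2]; this
    [p] is the limiting edge density. *)
Lemma clique_weights_sum_sqr : (0 < k)%N -> \sum_i v i ^+ 2 = 1 - p.
Proof.
move=> k_gt0; have [_ _] := coef12_prod_linear (index_enum 'I_k.+1) v.
rewrite vE coef_poly !ltnS k_gt0 clique_weights_sum binn expr1.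
by rewrite mulrC divfK ?pnatr_eq0 // expr1n => ->; rewrite subKr.
Qed.

Let G m := multipartite (part_size v m).

Let card_G m : #|G m| = m.+1.
Proof. by rewrite card_multipartite sum_part_size ?clique_weights_sum. Qed.

Let cvg_G := cvg_part_size v_ge0 clique_weights_sum.

(** The density is a finite sum, over injections into the parts, of products of part fractions. It
    converges termwise to [j!] times the coefficient of [X ^ j] in the clique polynomial. *)
Lemma clique_multipartite_copies j : (j <= k.+1)%N ->
  copies_asymptotic (complete_graph j) G (p ^+ 'C(j, 2)).
Proof.
move=> le_jk; apply/copies_asymptoticP; first exact: exprn_gt0.
  by move=> m; rewrite card_G.
have -> : p ^+ 'C(j, 2) = \sum_(f : {ffun 'I_j -> 'I_k.+1} | injectiveb f) \prod_i v (f i).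
  by rewrite sum_injective_ffun vE coef_poly ltnS le_jk mulrC divfK.
under eq_fun => m.
  rewrite card_G card_complete_copies natr_sum mulr_suml card_ord.
  under eq_bigr => f _.
    rewrite natr_prod -[X in _ ^+ X](card_ord j) -prodr_const -prodf_div.
    over.
  over.
apply: cvg_big => [|f _]; first exact: add_continuous.
by apply: cvg_big => [|i _]; [exact: mul_continuous | exact: cvg_G].
Qed.

(** With respect to the weights [v], the limiting relative degrees [1 - v i] have mean [p] and
    second moment [D]. The four-cycle bound gives [D <= p ^ 2], so their variance is zero. *)
Lemma clique_multipartite_C4 : (0 < k)%N ->
  copies_asymptotic C4 G (p ^+ 4) -> forall i, 0 < v i -> v i = 1 - p.
Proof.
move=> k_gt0 /copies_asymptoticP-/(_ (exprn_gt0 _ p_gt0)) C4_cvg.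
have {}C4_cvg : (#|labeled_copies C4 (G m)|%:R / m.+1%:R ^+ 4 : R) @[m --> \oo] --> p ^+ 4.
  have := C4_cvg (fun m => _); under eq_fun do rewrite card_G card_ord.
  by apply=> m; rewrite card_G.
pose D := \sum_i v i * (1 - v i) ^+ 2.
have D_ge0 : 0 <= D by apply: sumr_ge0 => i _; rewrite mulr_ge0 ?sqr_ge0.
have D_le : D <= p ^+ 2.
  rewrite -(@ler_pXn2r _ 2) ?nnegrE ?sqr_ge0 // -exprM.
  (* The summand [2 * 0] is the limit of the error term [2 / m.+1] from degenerate four-cycles. *)
  have -> : p ^+ (2 * 2) = p ^+ 4 + 2 * 0 by rewrite mulr0 addr0.
  apply: (ler_cvg_to (f := fun m => (\sum_i (part_size v m i)%:R / m.+1%:R *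
       (1 - (part_size v m i)%:R / m.+1%:R) ^+ 2) ^+ 2)
     (g := fun m => #|labeled_copies C4 (G m)|%:R / m.+1%:R ^+ 4 + 2 / m.+1%:R)
     (a := \oo)).
  - apply: cvg_sqr; apply: cvg_big => [|i _]; first exact: add_continuous.
    apply: cvgM; first exact: cvg_G.
    by apply: cvg_sqr; apply: cvgB; [exact: cvg_cst | exact: cvg_G].
  - apply: cvgD => //; apply: cvgM; [exact: cvg_cst | exact: cvg_harmonic].
  - apply: nearW => m.
    by have := @C4_copies_multipartite_ge R _ (part_size v m); rewrite card_G; apply.
have sum_sqr : \sum_i v i * (1 - v i - p) ^+ 2 = D - p ^+ 2.
  rewrite (eq_bigr (fun i => v i * (1 - v i) ^+ 2 + (2 * p * v i ^+ 2 +
    (p ^+ 2 - 2 * p) * v i))) => [|i _]; last by ring.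
  rewrite !big_split /= -!mulr_sumr clique_weights_sum clique_weights_sum_sqr //.
  by rewrite -/D; ring.
have term_ge0 i : 0 <= v i * (1 - v i - p) ^+ 2 by rewrite mulr_ge0 ?sqr_ge0.
move=> i vi_gt0; have /eqP : \sum_i v i * (1 - v i - p) ^+ 2 = 0.
  by apply/eqP; rewrite eq_le sumr_ge0 // sum_sqr subr_le0 D_le.
rewrite psumr_eq0 // => /allP/(_ i (mem_index_enum i)).
by rewrite mulf_eq0 gt_eqF //= sqrf_eq0 => /eqP; lra.
Qed.

End CliqueMultipartite.

(* The sequence of graphs and the failure of forcing *)
Close Scope classical_set_scope.

Theorem theorem2 (R : realType) (k : nat) (hk : (2 <= k)%N)
    (p : R) (hp0 : 0 < p) (hp : p <= 1 / 4) :
  (exists G : nat -> sgraph,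
    [/\ orders_to_infinity G,
        forall j : nat, (2 <= j <= k)%N ->
          copies_asymptotic (complete_graph j) G (p ^+ 'C(j, 2))
      & forall m : nat, exists2 S : {set G m},
          independent S & (#|G m|%:R / 2 <= #|S|%:R :> R)])
  /\ ~ forcing R (complete_family k).
Proof.
case: k hk => [//|k] k_gt0.
have [v [v_gt0 v_inj v0_gt vE]] := clique_poly_factorization k.+1 hp0 hp.
have v_ge0 i : 0 <= v i := ltW (v_gt0 i).
have sum_v := clique_weights_sum vE.
pose G m := multipartite (part_size v m).
have card_G m : #|G m| = m.+1 by rewrite card_multipartite sum_part_size.
have G_orders : orders_to_infinity G.
  apply/cvgnyPge => A; near do rewrite card_G ltnW //.
  by exists A.
have G_copies j : (2 <= j <= k.+1)%N ->
    copies_asymptotic (complete_graph j) G (p ^+ 'C(j, 2)).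
  by case/andP=> _; exact: clique_multipartite_copies.
split.
  (* The part of weight above 1/2 is independent, and since its size is never rounded down it
     contains at least half of the vertices for every [m]. *)
  exists G; split=> // m; exists (part _ ord0); first exact: independent_part.
  rewrite card_part card_G; apply: le_trans (part_size0 v_ge0 sum_v m).2.
  have := v0_gt ord0 erefl; have : 0 < m.+1%:R :> R by rewrite ltr0n.
  by nra.
move=> /(_ p); have p01 : 0 < p < 1 by apply/andP; split=> //; lra.
move=> /(_ p01 G G_orders) [].
  by move=> F [j j_itv ->]; rewrite card_edges_complete; exact: G_copies.
(* The four-cycle count would make every weight equal to [1 - p]. There are at least two parts and
   the weights are distinct, so this is a contradiction. *)
move=> _ _ /(clique_multipartite_C4 hp0 v_ge0 vE k_gt0) vE1.
have : ord0 = ord_max :> 'I_k.+1.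
  by apply: v_inj; rewrite (vE1 ord0 (v_gt0 _)) (vE1 ord_max (v_gt0 _)).
by move/(congr1 (@nat_of_ord _)) => /= k0; rewrite -k0 in k_gt0.
Unshelve. all: by end_near.
Qed.
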